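(* Let $T\ge 1$, $\gamma>0$ and $\beta>0$. Let $\boldsymbol\lambda_0=0$ and let $\boldsymbol\lambda_1,\dots,\boldsymbol\lambda_T\in\mathbb{R}^m$ satisfy $$\boldsymbol\lambda_{t+1}\in\underset{\boldsymbol\lambda\in\mathbb{R}^m}{\mathrm{argmin}}\Big\{f_\beta(\boldsymbol\lambda_t)+g_t\cdot(\boldsymbol\lambda-\boldsymbol\lambda_t)+\frac{1}{2\eta}\|\boldsymbol\lambda-\boldsymbol\lambda_t\|^2\Big\},\qquad t=0,\dots,T-1,$$ with step size $\eta=1/\beta$, where the gradient estimates $g_t\in\mathbb{R}^m$ satisfy $\|g_t-\nabla f_\beta(\boldsymbol\lambda_t)\|_*\le\gamma$ for all $t=0,\dots,T-1$. Then there exists $t\in\{0,\dots,T-1\}$ such that $$\|\nabla f_\beta(\boldsymbol\lambda_t)\|_*\le 3\gamma+2\sqrt{\frac{\beta\,\Delta e(C)}{T}}+2\sqrt{\frac{\log n}{T}}.$$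
   Context: Let $C,A_1,\dots,A_m\in\mathbb{R}^{n\times n}$ be symmetric and $\mathbf{b}\in\mathbb{R}^m$. For $\boldsymbol\lambda\in\mathbb{R}^m$ write $\boldsymbol\lambda\cdot\mathbf{A}=\sum_{i=1}^m\lambda_iA_i$. It is assumed that the semidefinite program of minimizing $\mathrm{Tr}[CX]$ over symmetric $X\in\mathbb{R}^{n\times n}$ subject to $\mathrm{Tr}[A_iX]=b_i$ ($i=1,\dots,m$), $\mathrm{Tr}[X]=1$, $X\succeq0$, is feasible. For $\beta>0$ define the (negated) dual objective of its entropic regularization $$f_\beta(\boldsymbol\lambda)=-\mathbf{b}\cdot\boldsymbol\lambda+\beta^{-1}\log\mathrm{Tr}\big[e^{-\beta(C-\boldsymbol\lambda\cdot\mathbf{A})}\big],\qquad \boldsymbol\lambda\in\mathbb{R}^m .$$ $\|\cdot\|$ is a norm on $\mathbb{R}^m$ such that $\|\boldsymbol\lambda\cdot\mathbf{A}\|_2\le\|\boldsymbol\lambda\|$ for all $\boldsymbol\lambda\in\mathbb{R}^m$, where $\|\cdot\|_2$ is the spectral norm; $\|\cdot\|_*$ is its dual norm. For a symmetric matrix $A$, $\Delta e(A)$ denotes its largest eigenvalue minus its smallest eigenvalue. *)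

(* Defs.v *)
From mathcomp Require Import all_boot all_order all_algebra.
From mathcomp Require Import all_classical all_reals all_analysis.

Set Implicit Arguments.
Unset Strict Implicit.
Unset Printing Implicit Defensive.
Import Order.TTheory GRing.Theory Num.Theory.
Import numFieldNormedType.Exports.
Local Open Scope classical_set_scope.
Local Open Scope ring_scope.

Definition dotv (R : realType) (m : nat) (u v : 'rV[R]_m) : R :=
  \sum_(i < m) u 0 i * v 0 i.

(* Nonnegativity follows from these axioms. *)
Definition is_norm (R : realType) (m : nat) (N : 'rV[R]_m -> R) : Prop :=
  [/\ forall x y, N (x + y) <= N x + N y,
      forall (a : R) x, N (a *: x) = `|a| * N x
    & forall x, N x = 0 -> x = 0].

(* sup over a nonempty set, bounded since any norm on R^m dominates a multiple
   of the Euclidean one. *)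
Definition dual_norm (R : realType) (m : nat) (N : 'rV[R]_m -> R)
    (g : 'rV[R]_m) : R :=
  sup [set dotv g x | x in [set x | N x <= 1]].

Definition enorm (R : realType) (n : nat) (v : 'cV[R]_n) : R :=
  Num.sqrt (\sum_(i < n) v i 0 ^+ 2).

(* Operator norm induced by the Euclidean norm; the library norm `|A| on
   matrices is the entrywise maximum instead. *)
Definition spectral_norm (R : realType) (n : nat) (A : 'M[R]_n) : R :=
  sup [set enorm (A *m v) | v in [set v | enorm v <= 1]].

Definition psd (R : realType) (n : nat) (X : 'M[R]_n) : Prop :=
  forall v : 'cV[R]_n, 0 <= (v^T *m X *m v) 0 0.

(* [eigenvalue] uses row eigenvectors, which gives the same spectrum as
   column eigenvectors. For symmetric A and n > 0 the set of eigenvalues is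
   finite and nonempty, so sup and inf are the largest and the smallest. *)
Definition eig_spread (R : realType) (n : nat) (A : 'M[R]_n) : R :=
  sup [set a : R | eigenvalue A a] - inf [set a : R | eigenvalue A a].

(* The limit is for the entrywise maximum norm, i.e. entrywise convergence. *)
Definition expmx (R : realType) (n : nat) (A : 'M[R]_n) : 'M[R]_n :=
  limn (series (fun k : nat => (k`!%:R)^-1 *: (A ^+ k : 'M[R]_n))).

Definition gradient (R : realType) (m : nat) (f : 'rV[R]_m -> R)
    (x : 'rV[R]_m) : 'rV[R]_m :=
  \row_(i < m) 'D_(delta_mx 0 i) f x.

Definition lincomb (R : realType) (n m : nat) (A : 'I_m -> 'M[R]_n)
    (lam : 'rV[R]_m) : 'M[R]_n :=
  \sum_(i < m) lam 0 i *: A i.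

(* Feasibility forces 0 < n through the trace-one constraint. *)
Definition sdp_feasible (R : realType) (n m : nat) (A : 'I_m -> 'M[R]_n)
    (b : 'rV[R]_m) : Prop :=
  exists X : 'M[R]_n,
    [/\ X \is symmetricmx, forall i, \tr (A i *m X) = b 0 i,
        \tr X = 1 & psd X].

Definition dual_objective (R : realType) (n m : nat) (C : 'M[R]_n)
    (A : 'I_m -> 'M[R]_n) (b : 'rV[R]_m) (beta : R) (lam : 'rV[R]_m) : R :=
  - dotv b lam + beta^-1 * ln (\tr (expmx (- beta *: (C - lincomb A lam)))).

Definition prox_model (R : realType) (m : nat) (N : 'rV[R]_m -> R)
    (f : 'rV[R]_m -> R) (eta : R) (g x y : 'rV[R]_m) : R :=
  f x + dotv g (y - x) + (2 * eta)^-1 * N (y - x) ^+ 2.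

Definition argmin (T : Type) (R : realType) (F : T -> R) : set T :=
  [set x | forall y, F x <= F y].

(* Main.v *)
From HB Require Import structures.
Require Import Defs.
From mathcomp Require Import all_boot all_order all_algebra.
From mathcomp Require Import all_classical all_reals all_analysis.
From mathcomp Require Import ring lra.
Import Order.TTheory GRing.Theory Num.Theory.
Import numFieldNormedType.Exports.
Local Open Scope classical_set_scope.
Local Open Scope ring_scope.

Set Implicit Arguments.
Unset Strict Implicit.
Unset Printing Implicit Defensive.

(** Let phi(H) = log Tr e^H and rho_H = e^H / Tr e^H. For symmetric H and
    G = H + D with eigenbases (u_i), (v_j) and eigenvalues a_i, b_j, the numbers
    <u_i, v_j>^2 are doubly stochastic, and weighting the pairs (i, j) with them
    turns rho_H and rho_G into two probability distributions on pairs whose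
    likelihood ratio is exp (d - c), where d = b_j - a_i, c = phi(G) - phi(H). The
    means of d are p = Tr (rho_H D) and q = Tr (rho_G D), and its second moments
    are at most |D|^2. The scalar inequalities 1 + x <= e^x and
    2 (e^x - 1) x <= x^2 (e^x + 1) then give p <= c <= q and
    q - p <= |D|^2 - p q. Applied along a fine subdivision of the segment from H
    to H + D, these yield phi(H + D) <= phi(H) + Tr (rho_H D) + |D|^2 / 2, without
    differentiating a matrix exponential. Hence the objective f is
    beta-smooth for the given norm.

    The proximal step of length q_t / beta, with q_t the dual norm of g_t, then
    decreases beta f by at least q_t (q_t - 2 gamma) / 2. Since
    beta (f(0) - inf f) <= beta Delta e(C) + log n, by evaluating the dual at a
    feasible X, some q_t is small. *)

(** * The spectral theorem for real symmetric matrices *)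

Section DotProduct.
Variables (R : realType) (n : nat).
Implicit Types u v w : 'rV[R]_n.

Lemma dotvE u v : dotv u v = (u *m v^T) 0 0.
Proof. by rewrite mxE; apply: eq_bigr => i _; rewrite mxE. Qed.

Lemma dotvC u v : dotv u v = dotv v u.
Proof. by apply: eq_bigr => i _; rewrite mulrC. Qed.

Lemma dotvDl u v w : dotv (u + v) w = dotv u w + dotv v w.
Proof. by rewrite !dotvE mulmxDl mxE. Qed.

Lemma dotvZl a u w : dotv (a *: u) w = a * dotv u w.
Proof. by rewrite !dotvE -scalemxAl mxE. Qed.

Lemma dotvNl u w : dotv (- u) w = - dotv u w.
Proof. by rewrite -scaleN1r dotvZl mulN1r. Qed.

Lemma dotvDr u v w : dotv u (v + w) = dotv u v + dotv u w.
Proof. by rewrite dotvC dotvDl !(dotvC _ u). Qed.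

Lemma dotvZr a u w : dotv u (a *: w) = a * dotv u w.
Proof. by rewrite dotvC dotvZl dotvC. Qed.

Lemma dotvNr u w : dotv u (- w) = - dotv u w.
Proof. by rewrite dotvC dotvNl dotvC. Qed.

Lemma dotv_ge0 u : 0 <= dotv u u.
Proof. by apply: sumr_ge0 => i _; rewrite -expr2 sqr_ge0. Qed.

Lemma dotv_eq0 u : dotv u u = 0 -> u = 0.
Proof.
move=> /eqP; rewrite psumr_eq0 => [/allP u0|i _]; last by rewrite -expr2 sqr_ge0.
apply/rowP => i; rewrite mxE; apply/eqP.
by have := u0 i (mem_index_enum i); rewrite mulf_eq0 orbb.
Qed.

Lemma dotv_mulmxl (H : 'M[R]_n) u v : dotv (u *m H) v = dotv u (v *m H^T).
Proof. by rewrite !dotvE trmx_mul trmxK mulmxA. Qed.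

End DotProduct.

Section SpectralTheorem.
Variable R : realType.

Lemma continuous_sum (T : topologicalType) (I : Type) (r : seq I)
    (F : I -> T -> R) :
  (forall i, continuous (F i)) -> continuous (fun x => \sum_(i <- r) F i x).
Proof.
move=> cF; elim: r => [|i r IHr].
  have -> : (fun x => \sum_(i <- [::]) F i x) = cst 0.
    by apply/funext => x; rewrite big_nil.
  by move=> x; exact: cvg_cst.
have -> : (fun x => \sum_(j <- i :: r) F j x) = F i \+ (fun x => \sum_(j <- r) F j x).
  by apply/funext => x; rewrite big_cons.
by move=> x; apply: cvgD; [exact: cF|exact: IHr].
Qed.

Lemma continuous_mul (T : topologicalType) (f g : T -> R) :
  continuous f -> continuous g -> continuous (fun x => f x * g x).
Proof. by move=> cf cg x; apply: cvgM; [exact: cf|exact: cg]. Qed.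

Lemma continuous_quadratic_form n (H : 'M[R]_n) :
  continuous (fun u : 'rV[R]_n => dotv (u *m H) u).
Proof.
have rowc i : continuous (fun u : 'rV[R]_n => (u *m H) 0 i).
  have -> : (fun u : 'rV[R]_n => (u *m H) 0 i) = (fun u => \sum_j u 0 j * H j i).
    by apply/funext => u; rewrite mxE.
  apply: continuous_sum => j; apply: continuous_mul; last exact: cst_continuous.
  exact: (@coord_continuous R 1 n 0 j).
apply: continuous_sum => i.
by apply: continuous_mul; [exact: rowc|exact: (@coord_continuous R 1 n 0 i)].
Qed.

Lemma sphere_compact n : compact [set u : 'rV[R]_n | dotv u u = 1].
Proof.
apply: bounded_closed_compact.
  exists 1; split => // M M1 u /= u1.
  apply: le_trans (ltW M1); rewrite [leLHS]/Num.norm /= mx_normrE.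
  apply/bigmax_leP; split => // -[i j] _ /=; rewrite (ord1 i).
  rewrite -(@ler_pXn2r _ 2) ?nnegrE // expr1n real_normK ?num_real// -u1.
  by rewrite /dotv (bigD1 j) //= -expr2 lerDl sumr_ge0 // => k _; rewrite -expr2 sqr_ge0.
(* The sphere is a level set of the quadratic form of the identity, hence closed. *)
have -> : [set u : 'rV[R]_n | dotv u u = 1] =
    (fun u => dotv (u *m 1%:M) u) @^-1` [set 1].
  by apply/seteqP; split => u /=; rewrite mulmx1.
apply: closed_comp; last exact: closed_eq.
by move=> u _; exact: continuous_quadratic_form.
Qed.

(** First-order optimality at [t = 0]. At [t = - a / B] with [B > |b|] the expression is
    [a ^ 2 * (b - 2 * B) / B ^ 2], negative unless [a = 0]. *)
Lemma linear_term_eq0 (a b : R) : (forall t, 0 <= 2 * t * a + t ^+ 2 * b) -> a = 0.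
Proof.
move=> ge0; apply/eqP; rewrite -sqrf_eq0 eq_le sqr_ge0 andbT.
pose B := `|b| + 1.
have B0 : 0 < B by rewrite ltr_wpDl.
have bB : b <= B by rewrite /B (le_trans (ler_norm b)) ?lerDl.
have := ge0 (- a / B).
have -> : 2 * (- a / B) * a + (- a / B) ^+ 2 * b = a ^+ 2 * (b - 2 * B) / B ^+ 2.
  by field; rewrite gt_eqF.
rewrite pmulr_lge0 ?invr_gt0 ?exprn_gt0// => h.
have := sqr_ge0 a; nra.
Qed.

(** Take [u] maximizing the quadratic form on the unit sphere, with maximum [mu]. The gap
    [mu |x|^2 - x H x] is nonnegative and vanishes at [u]; along the residual [w = mu u - u H] its
    first-order term is [2 t w.w], so [w = 0]. *)
Lemma symmetric_eigenvector n (H : 'M[R]_n.+1) : H^T = H ->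
  exists mu u, dotv u u = 1 /\ u *m H = mu *: u.
Proof.
move=> symH.
pose e0 : 'rV[R]_n.+1 := delta_mx 0 0.
have e01 : dotv e0 e0 = 1.
  rewrite /dotv (bigD1 0) //= big1 => [|i /negPf i0]; rewrite !mxE !eqxx ?i0 ?andbF.
    by rewrite mulr1 addr0.
  by rewrite mulr0.
have [||u Su umax] := @EVT_max_rV R n.+1 (fun u => dotv (u *m H) u)
    [set u : 'rV[R]_n.+1 | dotv u u = 1] _ (@sphere_compact _).
- by exists e0.
- by apply: continuous_subspaceT; exact: continuous_quadratic_form.
rewrite inE /= in Su.
pose mu := dotv (u *m H) u.
exists mu, u; split => //.
(* Homogeneity extends maximality from the sphere to all vectors. *)
have quad x : dotv (x *m H) x <= mu * dotv x x.
  have [x0|x0] := eqVneq (dotv x x) 0.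
    by rewrite (dotv_eq0 x0) mul0mx !dotvE !mul0mx mxE mulr0.
  have x_gt0 : 0 < dotv x x by rewrite lt_def x0 dotv_ge0.
  have sx : Num.sqrt (dotv x x) ^+ 2 = dotv x x by rewrite sqr_sqrtr ?dotv_ge0.
  have /umax : (Num.sqrt (dotv x x))^-1 *: x \in [set u : 'rV[R]_n.+1 | dotv u u = 1].
    rewrite inE /= dotvZl dotvZr mulrA -expr2 exprVn sx.
    by rewrite mulVf.
  rewrite -scalemxAl dotvZl dotvZr mulrA -expr2 exprVn sx -/mu.
  by rewrite mulrC ler_pdivrMr.
apply/eqP; rewrite eq_sym -subr_eq0; apply/eqP/dotv_eq0.
set w := _ - _.
apply: (@linear_term_eq0 _ (mu * dotv w w - dotv (w *m H) w)) => t.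
have := quad (u + t *: w).
have uHw : dotv (w *m H) u = dotv (u *m H) w by rewrite dotv_mulmxl symH dotvC.
have ww : dotv w w = mu * dotv u w - dotv (u *m H) w.
  by rewrite {1}/w dotvDl dotvNl dotvZl.
clearbody w; rewrite mulmxDl -scalemxAl !(dotvDl, dotvDr, dotvZl, dotvZr) uHw (dotvC w u) Su -/mu.
rewrite -subr_ge0; set a := dotv u w in ww *; set b := dotv (u *m H) w in ww *.
by move/le_trans; apply; rewrite ww le_eqVlt; apply/orP; left; apply/eqP; ring.
Qed.

(** The reflection in the hyperplane orthogonal to [u - e] exchanges the unit vectors [e] and
    [u]. *)
Lemma householder n (e u : 'rV[R]_n) : dotv e e = 1 -> dotv u u = 1 ->
  exists Q : 'M[R]_n, Q *m Q^T = 1%:M /\ e *m Q = u.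
Proof.
move=> e1 u1; have [->|eu] := eqVneq e u.
  by exists 1%:M; rewrite trmx1 !mulmx1.
pose w := u - e; pose s := dotv w w.
have s0 : s != 0.
  by apply: contra_neq eu => /dotv_eq0/eqP; rewrite subr_eq0 => /eqP.
have wwE : w *m w^T = s%:M.
  by apply/matrixP => i j; rewrite !ord1 [RHS]mxE mulr1n -dotvE.
pose Q := 1%:M - (2 / s) *: (w^T *m w).
have QT : Q^T = Q.
  by rewrite /Q linearB /= trmx1 linearZ /= trmx_mul trmxK.
exists Q; split.
  have ss : w^T *m w *m (w^T *m w) = s *: (w^T *m w).
    by rewrite mulmxA -(mulmxA w^T) wwE -scalemx1 -scalemxAr mulmx1 -scalemxAl.
  rewrite QT /Q; set P := w^T *m w in ss *.
  rewrite mulmxBl mul1mx mulmxBr mulmx1 -scalemxAl -scalemxAr ss.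
  by apply/matrixP => i j; rewrite !mxE; field.
have ew : e *m w^T = (- (s / 2))%:M.
  apply/matrixP => i j; rewrite !ord1 [RHS]mxE mulr1n -dotvE.
  by rewrite /s /w !(dotvDl, dotvDr, dotvNl, dotvNr) e1 u1 (dotvC u e); field.
rewrite mulmxBr mulmx1 -scalemxAr mulmxA ew mul_scalar_mx scalerA.
rewrite (_ : 2 / s * - (s / 2) = -1); last by field.
by rewrite scaleN1r opprK /w addrC subrK.
Qed.

(** Induction on the size: conjugation by a reflection that sends the first basis vector to an
    eigenvector splits off a block of size one. The rows of [U] are the eigenvectors. *)
Lemma spectral_symmetric n (H : 'M[R]_n) : H^T = H ->
  exists (U : 'M[R]_n) (a : 'rV[R]_n), U *m U^T = 1%:M /\ H = U^T *m diag_mx a *m U.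
Proof.
elim: n H => [|n IHn] H symH.
  by exists 1%:M, 0; split; apply/matrixP => -[].
have [mu [u [u1 uH]]] := symmetric_eigenvector symH.
pose e0 : 'rV[R]_(1 + n) := row_mx 1%:M 0.
have e01 : dotv e0 e0 = 1.
  by rewrite dotvE tr_row_mx mul_row_col trmx1 trmx0 mulmx0 addr0 mulmx1 mxE.
have [Q [QQT eQ]] := householder (e01 : dotv (e0 : 'rV_n.+1) e0 = 1) u1.
have QTQ : Q^T *m Q = 1%:M by exact: mulmx1C.
pose G : 'M[R]_(1 + n) := Q *m H *m Q^T.
have symG : G^T = G by rewrite /G !trmx_mul trmxK symH mulmxA.
have eG : e0 *m G = mu *: e0.
  have -> : e0 *m G = u *m H *m Q^T by rewrite /G -eQ !mulmxA.
  by rewrite uH -eQ -scalemxAl -mulmxA QQT mulmx1.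
(* The eigenvector equation determines the first row of [G]; symmetry then clears the first
   column. *)
have [Gul Gur] : ulsubmx G = mu%:M /\ ursubmx G = 0.
  move: eG; rewrite -[G]submxK mul_row_block mul1mx mul1mx !mul0mx !addr0.
  rewrite scale_row_mx scaler0 scalemx1 => /eq_row_mx [-> ->].
  by rewrite block_mxKul block_mxKur.
have Gdl : dlsubmx G = 0 by rewrite -symG -trmx_ursub Gur trmx0.
have [|U' [a' [UU' Gdr]]] := IHn (drsubmx G); first by rewrite trmx_drsub symG.
pose V : 'M[R]_(1 + n) := block_mx 1%:M 0 0 U'.
have VVT : V *m V^T = 1%:M.
  rewrite tr_block_mx mulmx_block !trmx0 trmx1 !mulmx0 !mul0mx !addr0 !add0r.
  by rewrite mulmx1 UU' -scalar_mx_block.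
exists (V *m Q), (row_mx mu%:M a'); split.
  by rewrite trmx_mul mulmxA -(mulmxA V) QQT mulmx1 VVT.
have -> : H = Q^T *m G *m Q.
  by rewrite /G !mulmxA QTQ mul1mx -mulmxA QTQ mulmx1.
suff -> : G = V^T *m diag_mx (row_mx mu%:M a') *m V by rewrite trmx_mul !mulmxA.
rewrite -[LHS]submxK Gul Gur Gdl Gdr diag_mx_row tr_block_mx !trmx0 trmx1.
rewrite !mulmx_block !mulmx0 !mul0mx !addr0 !add0r !mul1mx !mulmx1 !mul0mx.
congr block_mx; apply/matrixP => i j; rewrite !ord1 !mxE.
by rewrite eqxx.
Qed.

End SpectralTheorem.

(** * Exponentially tilted distributions and matrix exponentials *)

Section TiltedDistributions.
Variable R : realType.

(** For [x > 0] this is [tanh (x / 2) <= x / 2] with denominators cleared. *)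
Lemma expR_sub1_le (x : R) : 2 * (expR x - 1) * x <= x ^+ 2 * (expR x + 1).
Proof.
(* Replacing [x] by [- x] multiplies both sides by [expR (- x)]. *)
wlog x0 : x / 0 <= x => [hw|].
  have [|x0] := leP 0 x; first exact: hw.
  have := hw (- x); rewrite oppr_ge0 (ltW x0) => /(_ isT).
  have e0 := expR_gt0 x; have := expRN x => eN.
  have : expR x * expR (- x) = 1 by rewrite expRxMexpNx_1.
  move: (expR (- x)) eN => y _; nra.
(* Up to the factor [x], [g x] is the difference of the two sides. It vanishes at 0, and its
   derivative is nonnegative because [1 - t <= expR (- t)]. *)
pose g (t : R) := t * (expR t + 1) - 2 * (expR t - 1).
suff g0 : 0 <= g x by rewrite /g in g0; nra.
have dg (t : R) : is_derive t 1 g (t * expR t + 1 - expR t).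
  rewrite /g; apply: is_derive_eq; rewrite /GRing.scale /=; ring.
have -> : 0 = g 0 by rewrite /g expR0; ring.
have [->//|xneq0] := eqVneq x 0.
have x_gt0 : 0 < x by rewrite lt_def xneq0.
have [|c cx gE] := @MVT R g (fun t => t * expR t + 1 - expR t) 0 x x_gt0 (fun t _ => dg t).
  by apply: derivable_within_continuous => t _; exact: ex_derive.
rewrite -subr_ge0 gE subr0 mulr_ge0 //.
have := expR_ge1Dx (- c); have := expR_gt0 c.
have : expR c * expR (- c) = 1 by rewrite expRxMexpNx_1.
move: cx; rewrite in_itv /= => /andP[c0 _].
move: (expR (- c)) (expR c) => y z; nra.
Qed.

Variables (I : finType) (P Q d : I -> R) (c : R).
Hypotheses (P0 : forall i, 0 <= P i) (Q0 : forall i, 0 <= Q i).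
Hypotheses (P1 : \sum_i P i = 1) (Q1 : \sum_i Q i = 1).
Hypothesis PQ : forall i, Q i = P i * expR (d i - c).

Let sumC (p : I -> R) : \sum_i p i = 1 -> \sum_i p i * (d i - c) = \sum_i p i * d i - c.
Proof.
move=> p1; transitivity (\sum_i p i * d i - (\sum_i p i) * c); last by rewrite p1 mul1r.
by rewrite mulr_suml -sumrB; apply: eq_bigr => i _; rewrite mulrBr.
Qed.

(** The gap is the relative entropy of [P] with respect to [Q]; its sign follows from
    [1 + x <= expR x] at [x = d - c]. *)
Lemma tilted_mean_le : \sum_i P i * d i <= c.
Proof.
rewrite -subr_le0 -sumC // -[leRHS](subrr (1 : R)) -{1}Q1 -P1 -sumrB.
apply: ler_sum => i _; rewrite PQ; have := expR_ge1Dx (d i - c); have := P0 i; nra.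
Qed.

(** Likewise for the relative entropy of [Q] with respect to [P], with [x = c - d]. *)
Lemma tilted_mean_ge : c <= \sum_i Q i * d i.
Proof.
rewrite -subr_ge0 -sumC // -[leLHS](subrr (1 : R)) -{1}Q1 -P1 -sumrB.
apply: ler_sum => i _.
have -> : P i = Q i * expR (- (d i - c)).
  by rewrite PQ -mulrA expRxMexpNx_1 mulr1.
have := expR_ge1Dx (- (d i - c)); have := Q0 i; nra.
Qed.

(** Pointwise, [(Q - P) (d - c) <= (P + Q) (d - c) ^ 2 / 2]. With [p], [q] the two means, summing
    and expanding the squares gives [q - p <= K - c (p + q) + c ^ 2], and [(c - p) (c - q) <= 0]
    since [p <= c <= q]. *)
Lemma tilted_mean_lipschitz (K : R) :
  \sum_i P i * d i ^+ 2 <= K -> \sum_i Q i * d i ^+ 2 <= K ->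
  \sum_i Q i * d i - \sum_i P i * d i <=
    K - (\sum_i P i * d i) * (\sum_i Q i * d i).
Proof.
move=> PK QK; have := tilted_mean_le; have := tilted_mean_ge.
have sq (p : I -> R) : \sum_i p i = 1 ->
    \sum_i p i * (d i - c) ^+ 2 =
    \sum_i p i * d i ^+ 2 - 2 * c * (\sum_i p i * d i) + c ^+ 2.
  move=> p1; transitivity (\sum_i p i * d i ^+ 2 - 2 * c * (\sum_i p i * d i)
      + (\sum_i p i) * c ^+ 2); last by rewrite p1 mul1r.
  rewrite mulr_sumr mulr_suml -sumrB -big_split /=.
  by apply: eq_bigr => i _; ring.
have : \sum_i Q i * (d i - c) - \sum_i P i * (d i - c) <=
    2^-1 * (\sum_i P i * (d i - c) ^+ 2 + \sum_i Q i * (d i - c) ^+ 2).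
  rewrite -sumrB -big_split /= mulr_sumr; apply: ler_sum => i _.
  rewrite PQ; have := expR_sub1_le (d i - c); have := P0 i; nra.
rewrite !sumC // !sq //.
move: (\sum_i P i * d i) (\sum_i Q i * d i) PK QK => p q.
move: (\sum_i P i * d i ^+ 2) (\sum_i Q i * d i ^+ 2) => p2 q2; nra.
Qed.

End TiltedDistributions.

(** * Matrix exponentials in an eigenbasis *)

Section MatrixExponential.
Variable R : realType.

Lemma conj_diagE n (U : 'M[R]_n) (d : 'rV[R]_n) :
  U^T *m diag_mx d *m U = \sum_l d 0 l *: ((row l U)^T *m row l U).
Proof.
apply/matrixP => i j; rewrite !mxE summxE; apply: eq_bigr => l _.
by rewrite mul_mx_diag !mxE big_ord1 !mxE; ring.
Qed.

Lemma conj_diagX n (U : 'M[R]_n) (a : 'rV[R]_n) k : U *m U^T = 1%:M ->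
  (U^T *m diag_mx a *m U) ^+ k = U^T *m diag_mx (map_mx (fun x => x ^+ k) a) *m U.
Proof.
move=> UU; elim: k => [|k IHk].
  rewrite expr0 (_ : diag_mx _ = 1%:M); last first.
    by apply/matrixP => i j; rewrite !mxE expr0.
  by rewrite mulmx1 (mulmx1C UU).
rewrite exprS IHk -mulmxE.
have -> : U^T *m diag_mx a *m U *m (U^T *m diag_mx (map_mx (fun x => x ^+ k) a) *m U) =
   U^T *m (diag_mx a *m (U *m U^T) *m diag_mx (map_mx (fun x => x ^+ k) a)) *m U.
  by rewrite !mulmxA.
rewrite UU mulmx1 mulmx_diag; congr (_ *m diag_mx _ *m _).
by apply/rowP => i; rewrite !mxE exprS.
Qed.

Lemma cvg_lincomb n (I : Type) (r : seq I) (s : I -> nat -> R) (l : I -> R)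
    (E : I -> 'M[R]_n) : (forall i, s i @ \oo --> l i) ->
  (fun k => \sum_(i <- r) s i k *: E i) @ \oo --> \sum_(i <- r) l i *: E i.
Proof.
move=> sl; elim: r => [|i r IHr].
  by under eq_fun do rewrite big_nil; rewrite big_nil; exact: cvg_cst.
under eq_fun do rewrite big_cons; rewrite big_cons.
by apply: cvgD => //; apply: cvgZr_tmp.
Qed.

(** Written over the rank-one projections onto the eigenvectors, the partial sums are scalar
    exponential series times fixed matrices. *)
Lemma expmx_conj_diag n (U : 'M[R]_n) (a : 'rV[R]_n) : U *m U^T = 1%:M ->
  expmx (U^T *m diag_mx a *m U) = U^T *m diag_mx (map_mx expR a) *m U.
Proof.
move=> UU; apply/cvg_lim; first exact: norm_hausdorff.
rewrite (conj_diagE U (map_mx expR a)).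
rewrite [X in X @ _](_ : _ =
    (fun k => \sum_l series (exp_coeff (a 0 l)) k *: ((row l U)^T *m row l U))); last first.
  apply/funext => k; rewrite /series /=.
  under eq_bigr do rewrite conj_diagX // conj_diagE scaler_sumr.
  rewrite exchange_big; apply: eq_bigr => l _ /=.
  rewrite scaler_suml; apply: eq_bigr => i _.
  by rewrite scalerA /exp_coeff /= mxE mulrC.
apply: cvg_lincomb => l; rewrite mxE; exact: is_cvg_series_exp_coeff.
Qed.

End MatrixExponential.

(** * Smoothness of the log-trace-exponential *)

(* Locked, so that unification never unfolds matrix exponentials. *)
HB.lock Definition logtrexp (R : realType) (n : nat) (H : 'M[R]_n) : R :=
  ln (\tr (expmx H)).

HB.lock Definition gibbs (R : realType) (n : nat) (H : 'M[R]_n) : 'M[R]_n :=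
  (\tr (expmx H))^-1 *: expmx H.

Section LogTraceExp.
Variables (R : realType) (n : nat).
Hypothesis n_gt0 : (0 < n)%N.
Implicit Types (U V H G D : 'M[R]_n) (a b : 'rV[R]_n).

Definition partition_fun a := \sum_i expR (a 0 i).

Lemma partition_fun_gt0 a : 0 < partition_fun a.
Proof.
rewrite /partition_fun (bigD1 (Ordinal n_gt0)) //= ltr_wpDr ?expR_gt0//.
by apply: sumr_ge0 => i _; exact: expR_ge0.
Qed.

Lemma mxtrace_conj_diag U a X :
  \tr (U^T *m diag_mx a *m U *m X) = \sum_i a 0 i * (U *m X *m U^T) i i.
Proof.
rewrite -!mulmxA mxtrace_mulC -!mulmxA.
by apply: eq_bigr => i _; rewrite mul_diag_mx mxE mulmxA.
Qed.

Lemma mxtrace_expmx U a : U *m U^T = 1%:M ->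
  \tr (expmx (U^T *m diag_mx a *m U)) = partition_fun a.
Proof.
move=> UU; rewrite expmx_conj_diag // -[X in \tr X]mulmx1 mxtrace_conj_diag.
by apply: eq_bigr => i _; rewrite mulmx1 UU !mxE eqxx mulr1.
Qed.

Lemma mxtrace_gibbs U a X : U *m U^T = 1%:M ->
  \tr (gibbs (U^T *m diag_mx a *m U) *m X) =
  \sum_i expR (a 0 i) / partition_fun a * (U *m X *m U^T) i i.
Proof.
move=> UU; rewrite gibbs.unlock mxtrace_expmx // expmx_conj_diag // -scalemxAl mxtraceZ.
rewrite mxtrace_conj_diag mulr_sumr; apply: eq_bigr => i _.
by rewrite mxE mulrCA !mulrA.
Qed.

Lemma sum_gibbs_weights a : \sum_i expR (a 0 i) / partition_fun a = 1.
Proof. by rewrite -mulr_suml divff // gt_eqF // partition_fun_gt0. Qed.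

Lemma gibbs_weight_ge0 a i : 0 <= expR (a 0 i) / partition_fun a.
Proof. by rewrite divr_ge0 ?expR_ge0 // ltW // partition_fun_gt0. Qed.

Lemma dotv_row_orthogonal U i : U *m U^T = 1%:M -> dotv (row i U) (row i U) = 1.
Proof.
move=> UU; transitivity ((U *m U^T) i i); last by rewrite UU mxE eqxx.
by rewrite [RHS]mxE; apply: eq_bigr => j _; rewrite !mxE.
Qed.

(* The squared overlaps between the eigenbases of [H] and [G] couple the two
   spectra, and the moments of the differences of eigenvalues under this
   coupling are matrix elements of [G - H] and of its square. *)
Lemma eigenbasis_overlap U V a b i : U *m U^T = 1%:M -> V *m V^T = 1%:M ->
  let D := V^T *m diag_mx b *m V - U^T *m diag_mx a *m U in
  [/\ \sum_j (U *m V^T) i j ^+ 2 = 1,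
      \sum_j (U *m V^T) i j ^+ 2 * (b 0 j - a 0 i) = (U *m D *m U^T) i i
    & \sum_j (U *m V^T) i j ^+ 2 * (b 0 j - a 0 i) ^+ 2 =
        dotv (row i U *m D) (row i U *m D)].
Proof.
move=> UU VV D; have VTV := mulmx1C VV; have UTU := mulmx1C UU.
set W := U *m V^T.
have WW : W *m W^T = 1%:M.
  by rewrite /W trmx_mul trmxK mulmxA -(mulmxA U) VTV mulmx1.
have W1 : \sum_j W i j ^+ 2 = 1.
  transitivity ((W *m W^T) i i); last by rewrite WW mxE eqxx.
  by rewrite [RHS]mxE; apply: eq_bigr => j _; rewrite [W^T j i]mxE expr2.
have UDV : U *m D *m V^T = W *m diag_mx b - diag_mx a *m W.
  rewrite /D mulmxBr mulmxBl /W !mulmxA UU mul1mx -(mulmxA _ V) VV mulmx1.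
  by rewrite -!mulmxA.
have UDVE j : (U *m D *m V^T) i j = W i j * (b 0 j - a 0 i).
  by rewrite UDV mul_mx_diag mul_diag_mx; move: (W) => M; rewrite !mxE; ring.
split => //.
  have -> : U *m D *m U^T = U *m D *m V^T *m W^T.
    by rewrite /W trmx_mul trmxK mulmxA -(mulmxA _ V^T) VTV mulmx1.
  rewrite mxE; apply: eq_bigr => j _.
  by rewrite UDVE [W^T j i]mxE; ring.
have -> : dotv (row i U *m D) (row i U *m D) =
    dotv (row i U *m D *m V^T) (row i U *m D *m V^T).
  by rewrite [RHS]dotv_mulmxl trmxK -(mulmxA _ V^T) VTV mulmx1.
apply: eq_bigr => j _; rewrite -!row_mul [row _ _ _ _]mxE UDVE; ring.
Qed.

(** The bound [|D|_2 ^ 2 <= K] without suprema or roots, on row vectors so that it applies to the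
    rows of an eigenbasis. *)
Definition mx_sqnorm_le D (K : R) :=
  forall v : 'rV[R]_n, dotv (v *m D) (v *m D) <= K * dotv v v.

Lemma logtrexp_pair H G K : H^T = H -> G^T = G -> mx_sqnorm_le (G - H) K ->
  [/\ \tr (gibbs H *m (G - H)) <= logtrexp G - logtrexp H,
      logtrexp G - logtrexp H <= \tr (gibbs G *m (G - H))
    & \tr (gibbs G *m (G - H)) - \tr (gibbs H *m (G - H)) <=
        K - \tr (gibbs H *m (G - H)) * \tr (gibbs G *m (G - H))].
Proof.
move=> /spectral_symmetric [U [a [UU HE]]] /spectral_symmetric [V [b [VV GE]]] hK.
have ovU i := eigenbasis_overlap a b i UU VV.
have ovV j := eigenbasis_overlap b a j VV UU.
move: ovU ovV; rewrite /= -HE -GE.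
set W := U *m V^T => ovU ovV.
have trH X : \tr (gibbs H *m X) =
    \sum_i expR (a 0 i) / partition_fun a * (U *m X *m U^T) i i.
  by rewrite HE mxtrace_gibbs.
have trG X : \tr (gibbs G *m X) =
    \sum_j expR (b 0 j) / partition_fun b * (V *m X *m V^T) j j.
  by rewrite GE mxtrace_gibbs.
have -> : logtrexp H = ln (partition_fun a) by rewrite logtrexp.unlock HE mxtrace_expmx.
have -> : logtrexp G = ln (partition_fun b) by rewrite logtrexp.unlock GE mxtrace_expmx.
suff main p q : p = \tr (gibbs H *m (G - H)) -> q = \tr (gibbs G *m (G - H)) ->
    [/\ p <= ln (partition_fun b) - ln (partition_fun a),
        ln (partition_fun b) - ln (partition_fun a) <= q & q - p <= K - p * q].
  exact: main.
rewrite trH => ->; rewrite trG => -> {p q}.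
set Za := partition_fun a; set Zb := partition_fun b.
have Za0 : 0 < Za by exact: partition_fun_gt0.
have Zb0 : 0 < Zb by exact: partition_fun_gt0.
have WV i j : (V *m U^T) j i = W i j 
  by have -> : V *m U^T = W^T; [rewrite /W trmx_mul trmxK|rewrite mxE].
(* Two laws on pairs of eigenvalue indices sharing the squared overlaps: the first marginal of [P]
   is the Gibbs law of [H], the second marginal of [Q] that of [G]. *)
pose P (x : 'I_n * 'I_n) := expR (a 0 x.1) / Za * W x.1 x.2 ^+ 2.
pose Q (x : 'I_n * 'I_n) := expR (b 0 x.2) / Zb * W x.1 x.2 ^+ 2.
pose d (x : 'I_n * 'I_n) := b 0 x.2 - a 0 x.1.
have sumP (f : 'I_n * 'I_n -> R) : \sum_x P x * f x =
    \sum_i expR (a 0 i) / Za * \sum_j W i j ^+ 2 * f (i, j).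
  transitivity (\sum_i \sum_j P (i, j) * f (i, j)).
    by rewrite pair_bigA; apply: eq_bigr => -[].
  by apply: eq_bigr => i _; rewrite mulr_sumr; apply: eq_bigr => j _; rewrite mulrA.
have sumQ (f : 'I_n * 'I_n -> R) : \sum_x Q x * f x =
    \sum_j expR (b 0 j) / Zb * \sum_i W i j ^+ 2 * f (i, j).
  transitivity (\sum_j \sum_i Q (i, j) * f (i, j)).
    by rewrite exchange_big pair_bigA; apply: eq_bigr => -[].
  by apply: eq_bigr => i _; rewrite mulr_sumr; apply: eq_bigr => j _; rewrite mulrA.
have P1 : \sum_x P x = 1.
  transitivity (\sum_x P x * 1); first by apply: eq_bigr => x _; rewrite mulr1.
  rewrite (sumP (fun=> 1)) -[RHS](sum_gibbs_weights a); apply: eq_bigr => i _.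
  under eq_bigr do rewrite /= mulr1.
  by have [-> _ _] := ovU i; rewrite mulr1.
have Q1 : \sum_x Q x = 1.
  transitivity (\sum_x Q x * 1); first by apply: eq_bigr => x _; rewrite mulr1.
  rewrite (sumQ (fun=> 1)) -[RHS](sum_gibbs_weights b); apply: eq_bigr => j _.
  under eq_bigr do rewrite /= mulr1 -WV.
  by have [-> _ _] := ovV j; rewrite mulr1.
have Pd : \sum_i expR (a 0 i) / Za * (U *m (G - H) *m U^T) i i = \sum_x P x * d x.
  by rewrite sumP; apply: eq_bigr => i _; have [_ <- _] := ovU i.
have Qd : \sum_j expR (b 0 j) / Zb * (V *m (G - H) *m V^T) j j = \sum_x Q x * d x.
  rewrite sumQ; apply: eq_bigr => j _; congr (_ * _).
  (* With the eigenbases exchanged, the overlap identities concern [H - G], hence the sign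
     change. *)
  have [_ e _] := ovV j; rewrite -opprB mulmxN mulNmx mxE -e -sumrN.
  by apply: eq_bigr => i _; rewrite WV /d; ring.
have Pd2 : \sum_x P x * d x ^+ 2 <= K.
  rewrite sumP -[leRHS]mul1r -(sum_gibbs_weights a) mulr_suml.
  apply: ler_sum => i _; rewrite ler_wpM2l ?gibbs_weight_ge0 //.
  have [_ _ ->] := ovU i; apply: le_trans (hK _) _.
  by rewrite dotv_row_orthogonal // mulr1.
have Qd2 : \sum_x Q x * d x ^+ 2 <= K.
  rewrite sumQ -[leRHS]mul1r -(sum_gibbs_weights b) mulr_suml.
  apply: ler_sum => j _; rewrite ler_wpM2l ?gibbs_weight_ge0 //.
  have [_ _ e] := ovV j; have := hK (row j V).
  rewrite dotv_row_orthogonal // mulr1; apply: le_trans.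
  rewrite -opprB mulmxN dotvNl dotvNr opprK -e le_eqVlt; apply/orP; left.
  by apply/eqP/eq_bigr => i _; rewrite WV /d; ring.
have P0 x : 0 <= P x by rewrite mulr_ge0 ?gibbs_weight_ge0 ?sqr_ge0.
have Q0 x : 0 <= Q x by rewrite mulr_ge0 ?gibbs_weight_ge0 ?sqr_ge0.
have PQ x : Q x = P x * expR (d x - (ln Zb - ln Za)).
  rewrite /Q /P /d !expRB !lnK ?posrE //.
  by field; rewrite !gt_eqF ?expR_gt0.
rewrite Pd Qd; split.
- exact: tilted_mean_le P0 P1 Q1 PQ.
- exact: tilted_mean_ge Q0 P1 Q1 PQ.
- exact: (tilted_mean_lipschitz P0 Q0 P1 Q1 PQ Pd2 Qd2).
Qed.

(** The trace is a mean of the diagonal entries of [D] in an eigenbasis of [H]. Each squared entry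
    is at most the squared length of its row, hence at most [K]; nonnegativity of the variance
    transfers this to the mean. *)
Lemma gibbs_mean_sqr_le H D K : H^T = H -> mx_sqnorm_le D K ->
  \tr (gibbs H *m D) ^+ 2 <= K.
Proof.
move=> /spectral_symmetric [U [a [UU ->]]] hK; rewrite mxtrace_gibbs //.
pose p i := expR (a 0 i) / partition_fun a; pose x i := (U *m D *m U^T) i i.
set psi := \sum_i _; have psiE : psi = \sum_i p i * x i by [].
have p1 : \sum_i p i = 1 by exact: sum_gibbs_weights.
have p0 i : 0 <= p i by exact: gibbs_weight_ge0.
have xK i : x i ^+ 2 <= K.
  have := hK (row i U); rewrite dotv_row_orthogonal // mulr1; apply: le_trans.
  have -> : dotv (row i U *m D) (row i U *m D) =
      dotv (row i U *m D *m U^T) (row i U *m D *m U^T).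
    by rewrite [RHS]dotv_mulmxl trmxK -(mulmxA _ U^T) (mulmx1C UU) mulmx1.
  rewrite -!row_mul /dotv (bigD1 i) //= [row _ _ _ _]mxE -expr2 lerDl.
  by apply: sumr_ge0 => j _; rewrite -expr2 sqr_ge0.
have : 0 <= \sum_i p i * (x i - psi) ^+ 2.
  by apply: sumr_ge0 => i _; rewrite mulr_ge0 ?sqr_ge0.
have -> : \sum_i p i * (x i - psi) ^+ 2 = \sum_i p i * x i ^+ 2 - psi ^+ 2.
  transitivity (\sum_i p i * x i ^+ 2 - 2 * psi * (\sum_i p i * x i)
      + (\sum_i p i) * psi ^+ 2).
    rewrite mulr_sumr mulr_suml -sumrB -big_split /=.
    by apply: eq_bigr => i _; ring.
  by rewrite p1 -psiE; ring.
rewrite subr_ge0 => /le_trans; apply.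
rewrite -[leRHS]mul1r -p1 mulr_suml; apply: ler_sum => i _.
by rewrite ler_wpM2l.
Qed.

Lemma mxtrace_mulmxZ X (h : R) D : \tr (X *m (h *: D)) = h * \tr (X *m D).
Proof. by rewrite -scalemxAr mxtraceZ. Qed.

Lemma mx_sqnorm_leZ D (K h : R) :
  mx_sqnorm_le D K -> mx_sqnorm_le (h *: D) (h ^+ 2 * K).
Proof.
move=> hK v; rewrite -scalemxAr dotvZl dotvZr mulrA -expr2 -mulrA.
by rewrite ler_wpM2l ?sqr_ge0.
Qed.

Lemma le_archimedean (x y c : R) :
  (forall N : nat, x <= y + c / N.+1%:R) -> x <= y.
Proof.
move=> h; apply/ler_addgt0Pr => e e0.
have [N ceN] : exists N : nat, c / e < N.+1%:R.
  exists (Num.trunc `|c / e|); apply: le_lt_trans (ler_norm _) _.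
  by rewrite truncnS_gt.
apply: le_trans (h N) _; rewrite lerD2l ler_pdivrMr ?ltr0n // mulrC.
by rewrite -ler_pdivrMr // ltW.
Qed.

Lemma logtrexp_subgradient H D K : H^T = H -> D^T = D -> mx_sqnorm_le D K ->
  logtrexp H + \tr (gibbs H *m D) <= logtrexp (H + D).
Proof.
move=> symH symD hK; have DE : H + D - H = D by rewrite addrC addKr.
have [||] := @logtrexp_pair H (H + D) K symH; rewrite ?DE // ?linearD /= ?symH ?symD //.
by move=> h _ _; rewrite addrC -lerBrDr.
Qed.

(** The factor [1 + O(h ^ 2)] matters: a coarser constant times [h * K] would survive the limit of
    fine subdivisions. It is reached by bootstrapping a crude bound on [q - p]. *)
Lemma logtrexp_step H D K (h : R) : H^T = H -> D^T = D -> mx_sqnorm_le D K ->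
  0 < h ->
  logtrexp (H + h *: D) - logtrexp H <= h * \tr (gibbs (H + h *: D) *m D) /\
  \tr (gibbs (H + h *: D) *m D) - \tr (gibbs H *m D) <= h * K * (1 + h ^+ 2 * K).
Proof.
move=> symH symD hK h0.
have symG : (H + h *: D)^T = H + h *: D by rewrite linearD linearZ /= symH symD.
have p2 := gibbs_mean_sqr_le symH hK; have q2 := gibbs_mean_sqr_le symG hK.
have := mx_sqnorm_leZ h hK; have GH : H + h *: D - H = h *: D by rewrite addrC addKr.
rewrite -{1}GH => /(logtrexp_pair symH symG); rewrite GH !mxtrace_mulmxZ.
move: (\tr (gibbs H *m D)) (\tr (gibbs (H + h *: D) *m D)) p2 q2 => p q p2 q2.
move=> [l1 l2 l3]; split => //.
have pq : q - p <= h * (K - p * q).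
  by rewrite -(ler_pM2l h0); apply: le_trans (le_trans _ l3) _; lra.
have pq0 : 0 <= q - p by rewrite -(ler_pM2l h0); lra.
(* Crude bound, from [p ^ 2, q ^ 2 <= K]. *)
have pq1 : q - p <= 2 * (h * K).
  apply: le_trans pq _; have : - (p * q) <= K by have := sqr_ge0 (p + q); nra.
  by nra.
have pq2 : (q - p) ^+ 2 <= (2 * (h * K)) ^+ 2.
  by rewrite ler_sqr ?nnegrE //; nra.
have pq3 : - (p * q) <= (q - p) ^+ 2 / 4 by have := sqr_ge0 (p + q); nra.
by apply: le_trans pq _; nra.
Qed.

(** A discrete second-order Taylor bound; summing the increments of [psi] produces the triangular
    number [k (k + 1) / 2]. *)
Lemma discrete_smooth (phi psi : nat -> R) (h c : R) : 0 <= h ->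
  (forall k, phi k.+1 - phi k <= h * psi k.+1) ->
  (forall k, psi k.+1 - psi k <= c) ->
  forall k, phi k <= phi 0%N + k%:R * h * psi 0%N + h * c * (k%:R * (k%:R + 1) / 2).
Proof.
move=> h0 phiS psiS.
have psik k : psi k <= psi 0%N + k%:R * c.
  elim: k => [|k IHk]; first by rewrite mul0r addr0.
  have := psiS k; rewrite -natr1; move: (psi 0%N) (psi k) (psi k.+1) IHk => x y z; lra.
elim=> [|k IHk]; first by rewrite !mul0r !mulr0 !addr0.
have := phiS k; have := psik k.+1; rewrite -natr1 => /(ler_wpM2l h0).
move: (psi 0%N) (psi k.+1) (phi 0%N) (phi k) (phi k.+1) IHk => x y z t u; lra.
Qed.

Lemma logtrexp_smooth H D K : H^T = H -> D^T = D -> mx_sqnorm_le D K ->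
  logtrexp (H + D) <= logtrexp H + \tr (gibbs H *m D) + K / 2.
Proof.
move=> symH symD hK.
have K0 : 0 <= K := le_trans (sqr_ge0 _) (gibbs_mean_sqr_le symH hK).
(* With [h = 1 / (N + 1)] the discrete bound has remainder [K (1 + h ^ 2 K) (1 + h) / 2], which
   exceeds [K / 2] by at most [h (K + 2 K ^ 2) / 2] because [h <= 1]. *)
apply: (@le_archimedean _ _ ((K + 2 * K ^+ 2) / 2)) => N.
pose h : R := N.+1%:R^-1.
have h0 : 0 < h by rewrite invr_gt0 ltr0n.
have h1 : h <= 1 by rewrite invf_le1 ?ltr0n // ler1n.
have Nh : N.+1%:R * h = 1 by rewrite mulfV // pnatr_eq0.
pose Hs (k : nat) := H + (k%:R * h) *: D.
have Hs0 : Hs 0%N = H by rewrite /Hs mul0r scale0r addr0.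
have HsN : Hs N.+1 = H + D by rewrite /Hs Nh scale1r.
have HsS k : Hs k.+1 = Hs k + h *: D.
  by rewrite /Hs -natr1 mulrDl mul1r scalerDl addrA.
have symHs k : (Hs k)^T = Hs k by rewrite /Hs linearD linearZ /= symH symD.
have step k := logtrexp_step (symHs k) symD hK h0.
have := @discrete_smooth (fun k => logtrexp (Hs k)) (fun k => \tr (gibbs (Hs k) *m D))
  h (h * K * (1 + h ^+ 2 * K)) (ltW h0).
move=> /(_ _ _ N.+1); rewrite HsN Hs0 Nh mul1r => main.
apply: le_trans (main _ _) _ => [k|k|].
- by rewrite HsS; case: (step k).
- by rewrite HsS; case: (step k).
rewrite -[leRHS]addrA lerD2l -/h => {main step}.
have -> : h * (h * K * (1 + h ^+ 2 * K)) * (N.+1%:R * (N.+1%:R + 1) / 2) =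
   K * (1 + h ^+ 2 * K) * ((N.+1%:R * h) * (N.+1%:R * h + h)) / 2 by ring.
rewrite Nh mul1r; have KK : 0 <= K ^+ 2 := sqr_ge0 K.
have hK2 : h ^+ 2 * K ^+ 2 <= h * K ^+ 2.
  by rewrite ler_wpM2r // expr2 -[leRHS]mulr1 ler_wpM2l // ltW.
have hK3 : h ^+ 3 * K ^+ 2 <= h * K ^+ 2.
  have h2 : h ^+ 2 <= 1 by rewrite exprn_ile1 // ltW.
  by rewrite ler_wpM2r // exprS -[leRHS]mulr1 ler_wpM2l // ltW.
lra.
Qed.

End LogTraceExp.

(** * Dual norms and proximal steps *)

Lemma continuous_dist (R : realType) (T : topologicalType) (f : T -> R) (c : R) :
  continuous f -> continuous (fun x => `|f x - c|).
Proof.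
by move=> cf x; apply: cvg_norm; apply: cvgB; [exact: cf|exact: cvg_cst].
Qed.

Lemma continuous_at_dominated (R : realType) (T : topologicalType) (f G : T -> R) x :
  (forall y, `|f x - f y| <= G y) -> G x = 0 -> {for x, continuous G} ->
  {for x, continuous f}.
Proof.
move=> fG G0 /cvgrPdist_lt cG; apply/cvgrPdist_lt => e e0.
apply: filterS (cG e e0) => y; rewrite G0 sub0r normrN; apply: le_lt_trans.
by apply: le_trans (fG y) (ler_norm _).
Qed.

Section DualNorm.
Variables (R : realType) (m : nat) (N : 'rV[R]_m -> R).
Hypothesis hN : is_norm N.
Implicit Types x y g d : 'rV[R]_m.

Lemma is_normD x y : N (x + y) <= N x + N y. Proof. by case: hN. Qed.

Lemma is_normZ (a : R) x : N (a *: x) = `|a| * N x. Proof. by case: hN. Qed.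

Lemma is_norm_eq0 x : N x = 0 -> x = 0. Proof. by case: hN => _ _; apply. Qed.

Lemma is_norm0 : N 0 = 0. Proof. by rewrite -(scale0r 0) is_normZ normr0 mul0r. Qed.

Lemma is_normN x : N (- x) = N x.
Proof. by rewrite -scaleN1r is_normZ normrN normr1 mul1r. Qed.

Lemma is_norm_ge0 x : 0 <= N x.
Proof. by have := is_normD x (- x); rewrite subrr is_norm0 is_normN; lra. Qed.

Lemma is_norm_gt0 x : x != 0 -> 0 < N x.
Proof.
move=> x0; rewrite lt_def is_norm_ge0 andbT.
by apply: contra_neq x0; exact: is_norm_eq0.
Qed.

(** The reverse triangle inequality and expansion in the standard basis bound [|N x - N y|] by a
    continuous function vanishing at [x]. *)
Lemma is_norm_continuous : continuous N.
Proof.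
move=> x; pose G y := \sum_(i < m) `|(y - x) 0 i| * N (delta_mx 0 i).
have NG y : `|N x - N y| <= G y.
  have le1 (u v : 'rV[R]_m) : N u - N v <= N (u - v).
    by rewrite lerBlDr -{1}(subrK v u) is_normD.
  have NyG : N (y - x) <= G y.
    rewrite {1}(row_sum_delta (y - x)) /G; elim/big_ind2 : _ => [|u p v q up vq|i _].
    - by rewrite is_norm0.
    - by apply: le_trans (is_normD _ _) _; exact: lerD.
    - by rewrite is_normZ.
  apply: le_trans NyG; have := le1 x y; have := le1 y x.
  rewrite -(is_normN (x - y)) opprB ler_norml => l1 l2.
  by apply/andP; split; lra.
have cG : continuous G.
  apply: continuous_sum => i; apply: continuous_mul; last exact: cst_continuous.
  have -> : (fun y : 'rV[R]_m => `|(y - x) 0 i|) = (fun y => `|y 0 i - x 0 i|).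
    by apply/funext => y; rewrite !mxE.
  by apply: continuous_dist; exact: (@coord_continuous R 1 m 0 i).
have G0 : G x = 0.
  by rewrite /G big1 // => i _; rewrite subrr mxE normr0 mul0r.
exact: continuous_at_dominated NG G0 (cG x).
Qed.

(** [N] attains a positive minimum on the compact Euclidean sphere. This makes the supremum defining
    the dual norm finite. *)
Lemma is_norm_ball_bounded : exists B : R, forall x, N x <= 1 -> dotv x x <= B.
Proof.
have unit_sphere x : dotv x x != 0 ->
    dotv ((Num.sqrt (dotv x x))^-1 *: x) ((Num.sqrt (dotv x x))^-1 *: x) = 1.
  move=> x0; rewrite dotvZl dotvZr mulrA -expr2 exprVn sqr_sqrtr ?dotv_ge0 //.
  by rewrite mulVf.
have [S0|S0] := pselect ([set u : 'rV[R]_m | dotv u u = 1] !=set0); last first.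
  (* An empty sphere occurs only when every vector is zero. *)
  exists 0 => x _; have [->//|x0] := eqVneq (dotv x x) 0.
  by exfalso; apply: S0; exists ((Num.sqrt (dotv x x))^-1 *: x); exact: unit_sphere.
have [|u Su umin] := @EVT_min_rV R m N _ S0 (@sphere_compact R m).
  by apply: continuous_subspaceT; exact: is_norm_continuous.
rewrite inE /= in Su.
have Nu : 0 < N u.
  apply: is_norm_gt0; apply: contra_eq_neq Su => ->.
  by rewrite dotvE mul0mx mxE eq_sym oner_neq0.
exists ((N u)^-1 ^+ 2) => x x1.
have [->|x0] := eqVneq (dotv x x) 0; first exact: sqr_ge0.
have sx0 : 0 < Num.sqrt (dotv x x) by rewrite sqrtr_gt0 lt_def x0 dotv_ge0.
rewrite -[leLHS](sqr_sqrtr (dotv_ge0 x)) ler_sqr ?nnegrE ?invr_ge0 ?(ltW Nu) ?(ltW sx0) //.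
have := umin _ (mem_set (unit_sphere x x0)).
rewrite is_normZ ger0_norm ?invr_ge0 ?(ltW sx0) // ler_pdivlMl // => le.
by rewrite -[leRHS]mul1r ler_pdivlMr // (le_trans le).
Qed.

Lemma dotv_le_dual_norm_ball g x : N x <= 1 -> dotv g x <= dual_norm N g.
Proof.
move=> x1; apply: ub_le_sup; last by exists x.
have [B hB] := is_norm_ball_bounded.
(* From [0 <= |g - y| ^ 2]. *)
exists (2^-1 * (dotv g g + B)) => _ [y y1 <-].
have := dotv_ge0 (g - y); have := hB y y1.
by rewrite !(dotvDl, dotvDr, dotvNl, dotvNr) (dotvC y g); lra.
Qed.

Lemma dual_norm_le g (B : R) :
  (forall x, N x <= 1 -> dotv g x <= B) -> dual_norm N g <= B.
Proof.
move=> h; apply: ge_sup => [|_ [x x1 <-]]; last exact: h.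
by exists (dotv g 0), 0 => //=; rewrite is_norm0.
Qed.

Lemma dual_norm_ge0 g : 0 <= dual_norm N g.
Proof.
have := @dotv_le_dual_norm_ball g 0; rewrite is_norm0 ler01 => /(_ isT).
by rewrite dotvE trmx0 mulmx0 mxE.
Qed.

Lemma dotv_le_dual_norm g x : dotv g x <= dual_norm N g * N x.
Proof.
have [->|x0] := eqVneq x 0; first by rewrite is_norm0 mulr0 dotvE trmx0 mulmx0 mxE.
have Nx := is_norm_gt0 x0.
have := @dotv_le_dual_norm_ball g ((N x)^-1 *: x).
rewrite is_normZ ger0_norm ?invr_ge0 ?(ltW Nx) // mulVf ?gt_eqF // => /(_ (lexx _)).
by rewrite dotvZr ler_pdivrMl // mulrC.
Qed.

Lemma dual_normD g d : dual_norm N (g + d) <= dual_norm N g + dual_norm N d.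
Proof.
by apply: dual_norm_le => x x1; rewrite dotvDl lerD // dotv_le_dual_norm_ball.
Qed.

Lemma dual_normN g : dual_norm N (- g) = dual_norm N g.
Proof.
have le u : dual_norm N (- u) <= dual_norm N u.
  apply: dual_norm_le => x x1; rewrite dotvNl -dotvNr.
  by apply: dotv_le_dual_norm_ball; rewrite is_normN.
by apply/eqP; rewrite eq_le le /= -{1}(opprK g) le.
Qed.

(* The minimum of [g . d + beta / 2 * N d ^ 2] is [- q ^ 2 / (2 beta)] and is
   attained at length [q / beta], where [q] is the dual norm of [g]. *)
Lemma prox_minimizer (f : 'rV[R]_m -> R) (beta : R) g x y : 0 < beta ->
  argmin (prox_model N f beta^-1 g x) y ->
  dotv g (y - x) + beta / 2 * N (y - x) ^+ 2 <= - (dual_norm N g ^+ 2 / (2 * beta))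
  /\ N (y - x) = dual_norm N g / beta.
Proof.
move=> b0 ymin; set q := dual_norm N g; set d := y - x.
set M := dotv g d + beta / 2 * N d ^+ 2.
have half : (2 * beta^-1)^-1 = beta / 2 by field; rewrite gt_eqF.
have Mmin e : M <= dotv g e + beta / 2 * N e ^+ 2.
  have := ymin (x + e); rewrite /prox_model /M [x + e - x]addrC addKr half -!addrA.
  by rewrite lerD2l.
have M0 : M <= 0.
  by have := Mmin 0; rewrite is_norm0 expr0n mulr0 addr0 dotvE trmx0 mulmx0 mxE.
have q0 : 0 <= q by exact: dual_norm_ge0.
(* For [z] in the unit ball with [s = g.z >= 0], comparison with the displacement [- (s / beta) z]
   gives [M <= - s ^ 2 / (2 beta)]. The square root puts the claim in the form of an upper bound on
   the supremum [q]. *)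
have qM : q ^+ 2 <= - (2 * beta * M).
  have rhs0 : 0 <= - (2 * beta * M) by nra.
  rewrite -[leRHS]sqr_sqrtr // ler_sqr ?nnegrE ?sqrtr_ge0 //.
  apply: dual_norm_le => z z1.
  have [s0|s0] := leP 0 (dotv g z); last exact: le_trans (ltW s0) (sqrtr_ge0 _).
  rewrite -ler_sqr ?nnegrE ?sqrtr_ge0 // sqr_sqrtr //.
  have := Mmin (- (dotv g z / beta) *: z).
  rewrite dotvZr is_normZ normrN exprMn real_normK ?num_real //.
  move: (dotv g z) s0 => s s0 hM.
  have z2 : N z ^+ 2 <= 1 by rewrite exprn_ile1 // is_norm_ge0.
  have -> : s ^+ 2 = 2 * beta * (s ^+ 2 / beta - s ^+ 2 / (2 * beta)).
    by field; rewrite gt_eqF.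
  rewrite -[leRHS]mulrN ler_wpM2l ?mulr_ge0 ?(ltW b0) // lerNr; apply: le_trans hM _.
  rewrite opprB [leRHS]addrC mulNr; apply: lerD.
    by rewrite lerN2 expr2 mulrAC.
  have -> : s ^+ 2 / (2 * beta) = beta / 2 * ((s / beta) ^+ 2 * 1).
    by field; rewrite gt_eqF.
  by rewrite ler_wpM2l ?divr_ge0 ?(ltW b0) // ler_wpM2l ?sqr_ge0.
have gd : - (q * N d) <= dotv g d.
  by rewrite lerNl -dotvNr -(is_normN d) dotv_le_dual_norm.
split.
  by rewrite lerNr ler_pdivrMr ?mulr_gt0 // mulrC mulrN.
apply: (mulIf (lt0r_neq0 b0)); rewrite divfK ?gt_eqF // mulrC.
(* The bounds [qM] and [gd] combine into [(beta * N d - q) ^ 2 <= 0]. *)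
apply/eqP; rewrite -subr_eq0 -sqrf_eq0 eq_le sqr_ge0 andbT.
have := sqr_ge0 (N d); rewrite /M in qM; nra.
Qed.

End DualNorm.

(** * Spectral bounds *)

Section SpectralNorm.
Variables (R : realType) (n : nat).
Implicit Types D : 'M[R]_n.

Lemma symmetricmxE D : D \is symmetricmx -> D^T = D.
Proof. by rewrite qualifE /= expr0 scale1r map_mx_id // => /eqP/esym. Qed.

Lemma enorm_tr (v : 'rV[R]_n) : enorm v^T = Num.sqrt (dotv v v).
Proof.
by rewrite /enorm; congr Num.sqrt; apply: eq_bigr => i _; rewrite !mxE expr2.
Qed.

(** Coordinates of a vector in the unit ball are at most 1 in absolute value, so absolute row sums
    bound the image. *)
Lemma spectral_norm_has_ubound D :
  has_ubound [set enorm (D *m v) | v in [set v : 'cV[R]_n | enorm v <= 1]].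
Proof.
exists (Num.sqrt (\sum_i (\sum_j `|D i j|) ^+ 2)) => _ [v /= v1 <-].
rewrite /enorm ler_wsqrtr //; apply: ler_sum => i _.
rewrite -[leLHS]real_normK ?num_real // ler_sqr ?nnegrE ?sumr_ge0 // mxE.
apply: le_trans (ler_norm_sum _ _ _) _; apply: ler_sum => j _.
rewrite normrM ler_piMr //; apply: le_trans v1.
rewrite -[leLHS]sqrtr_sqr /enorm ler_wsqrtr // (bigD1 j) //= lerDl.
by apply: sumr_ge0 => k _; exact: sqr_ge0.
Qed.

Lemma spectral_norm_sqnorm_le D (K : R) : D^T = D -> spectral_norm D <= K ->
  mx_sqnorm_le D (K ^+ 2).
Proof.
move=> symD DK v; have [v0|v0] := eqVneq (dotv v v) 0.
  by rewrite (dotv_eq0 v0) mul0mx !dotvE mul0mx mxE mulr0.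
have v_gt0 : 0 < dotv v v by rewrite lt_def v0 dotv_ge0.
have sv : 0 < Num.sqrt (dotv v v) by rewrite sqrtr_gt0.
pose w := (Num.sqrt (dotv v v))^-1 *: v.
have ww : dotv w w = 1.
  by rewrite /w dotvZl dotvZr mulrA -expr2 exprVn sqr_sqrtr ?dotv_ge0 // mulVf.
have : enorm (D *m w^T) <= K.
  apply: le_trans DK; apply: ub_le_sup; first exact: spectral_norm_has_ubound.
  by exists w^T => //=; rewrite enorm_tr ww sqrtr1.
have -> : D *m w^T = (w *m D)^T by rewrite trmx_mul symD.
rewrite enorm_tr => h; have K0 : 0 <= K := le_trans (sqrtr_ge0 _) h.
move: h; rewrite -ler_sqr ?nnegrE ?sqrtr_ge0 // sqr_sqrtr ?dotv_ge0 //.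
rewrite /w -scalemxAl dotvZl dotvZr mulrA -expr2 exprVn sqr_sqrtr ?dotv_ge0 //.
by rewrite ler_pdivrMl // mulrC.
Qed.

End SpectralNorm.

Section EigenvalueBounds.
Variables (R : realType) (n : nat) (U : 'M[R]_n) (c : 'rV[R]_n).
Hypothesis UU : U *m U^T = 1%:M.
Let C := U^T *m diag_mx c *m U.

(** In the basis [U] an eigenvector becomes one of the diagonal matrix; any nonzero coordinate of it
    identifies the eigenvalue. *)
Lemma conj_diag_eigenvalueP (a : R) : eigenvalue C a <-> exists i, c 0 i = a.
Proof.
split=> [/eigenvalueP [v vC v0]|[i <-]].
  pose w := v *m U^T.
  have w0 : w != 0.
    apply: contra_neq v0 => w0.
    by rewrite -[v]mulmx1 -(mulmx1C UU) mulmxA -/w w0 mul0mx.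
  have wc : w *m diag_mx c = a *: w.
    by rewrite /w scalemxAl -vC /C !mulmxA -(mulmxA _ U) UU mulmx1.
  have [i wi] := rV0Pn _ w0.
  exists i; apply: (mulfI wi); rewrite [RHS]mulrC.
  by move/rowP: wc => /(_ i); rewrite mul_mx_diag !mxE.
apply/eigenvalueP; exists (row i U).
  rewrite /C !mulmxA -row_mul UU row1 -rowE row_diag_mx -scalemxAl.
  by rewrite -rowE.
apply/eqP => /(congr1 (fun v => dotv v v)).
rewrite (dotv_row_orthogonal i UU) dotvE mul0mx mxE => /eqP.
by rewrite oner_eq0.
Qed.

Lemma eigenvalue_bounds i :
  inf [set a : R | eigenvalue C a] <= c 0 i <= sup [set a : R | eigenvalue C a].
Proof.
have cE j : [set a : R | eigenvalue C a] (c 0 j).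
  by apply/conj_diag_eigenvalueP; exists j.
have cb (a : R) : eigenvalue C a -> `|a| <= \sum_j `|c 0 j|.
  move=> /conj_diag_eigenvalueP [j <-]; rewrite (bigD1 j) //= lerDl.
  exact: sumr_ge0.
apply/andP; split; [apply: ge_inf => // | apply: ub_le_sup => //].
  by exists (- \sum_j `|c 0 j|) => a /cb; rewrite ler_norml => /andP[].
by exists (\sum_j `|c 0 j|) => a /cb; rewrite ler_norml => /andP[].
Qed.

End EigenvalueBounds.

(** * Energies of density matrices and values of the log-trace-exponential *)

Section LogTraceExpBounds.
Variables (R : realType) (n : nat).
Hypothesis n_gt0 : (0 < n)%N.
Implicit Types (C H X : 'M[R]_n).

Lemma conj_psd_diag (U : 'M[R]_n) X i : psd X -> 0 <= (U *m X *m U^T) i i.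
Proof.
move=> /(_ (row i U)^T); rewrite trmxK; congr (0 <= _).
rewrite -row_mul [LHS]mxE [RHS]mxE; apply: eq_bigr => j _.
by rewrite [row _ _ _ _]mxE !tr_row !mxE.
Qed.

Lemma sum_conj_diag (U : 'M[R]_n) X : U *m U^T = 1%:M ->
  \sum_i (U *m X *m U^T) i i = \tr X.
Proof.
move=> UU; rewrite -[RHS]/(\tr X) -[X in \tr X]mulmx1 -(mulmx1C UU) mulmxA.
by rewrite mxtrace_mulC mulmxA.
Qed.

(** The diagonal of [X] in an eigenbasis of [H] is a probability vector, so the trace is a mean of
    eigenvalues, each at most the log of the sum of their exponentials. *)
Lemma mxtrace_le_logtrexp H X : H^T = H -> psd X -> \tr X = 1 ->
  \tr (H *m X) <= logtrexp H.
Proof.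
move=> /spectral_symmetric [U [a [UU ->]]] Xpsd X1.
rewrite mxtrace_conj_diag logtrexp.unlock mxtrace_expmx //.
rewrite -[leRHS]mulr1 -X1 -(sum_conj_diag X UU) mulr_sumr.
apply: ler_sum => i _; rewrite ler_wpM2r ?conj_psd_diag //.
rewrite -[leLHS]expRK ler_ln ?posrE ?expR_gt0 ?partition_fun_gt0 //.
rewrite /partition_fun (bigD1 i) //= lerDl; apply: sumr_ge0 => j _.
exact: expR_ge0.
Qed.

Lemma mxtrace_le_max_eigenvalue C X : C^T = C -> psd X -> \tr X = 1 ->
  \tr (C *m X) <= sup [set a : R | eigenvalue C a].
Proof.
move=> /spectral_symmetric [U [c [UU ->]]] Xpsd X1.
rewrite mxtrace_conj_diag -[leRHS]mulr1 -X1 -(sum_conj_diag X UU) mulr_sumr.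
apply: ler_sum => i _; rewrite ler_wpM2r ?conj_psd_diag //.
by have /andP[] := eigenvalue_bounds c UU i.
Qed.

Lemma logtrexp_le C (beta : R) : C^T = C -> 0 <= beta ->
  logtrexp (- beta *: C) <= ln n%:R - beta * inf [set a : R | eigenvalue C a].
Proof.
move=> /spectral_symmetric [U [c [UU CE]]] beta0.
set e := inf _.
have -> : - beta *: C = U^T *m diag_mx (- beta *: c) *m U.
  by rewrite CE linearZ /= -scalemxAr -scalemxAl.
rewrite logtrexp.unlock mxtrace_expmx // -[X in _ - X]expRK -ln_div ?posrE ?ltr0n ?expR_gt0 //.
rewrite ler_ln ?posrE ?partition_fun_gt0 ?divr_gt0 ?ltr0n ?expR_gt0 //.
rewrite -expRN /partition_fun mulr_natl -[X in _ *+ X]card_ord -sumr_const.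
apply: ler_sum => i _; rewrite ler_expR mxE mulNr lerN2 ler_wpM2l //.
by rewrite /e CE; have /andP[] := eigenvalue_bounds c UU i.
Qed.

Lemma eig_spread_ge0 C : C^T = C -> 0 <= eig_spread C.
Proof.
move=> /spectral_symmetric [U [c [UU ->]]]; rewrite subr_ge0.
by have /andP[] := eigenvalue_bounds c UU (Ordinal n_gt0); exact: le_trans.
Qed.

End LogTraceExpBounds.

(** * Descent on the dual objective *)

(** The difference quotient is within [|h| * c] of [l]. This identifies derivatives of the objective
    from the convexity and smoothness bounds alone. *)
Lemma derive_quadratic_bound (R : realType) (V : normedModType R) (f : V -> R)
    (x v : V) (l c : R) :
  (forall h : R, 0 <= f (x + h *: v) - f x - h * l <= h ^+ 2 * c) -> 'D_v f x = l.
Proof.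
move=> hf; apply/cvg_lim => //.
apply/cvgrPdist_lt => e e0.
have c0 : 0 <= c by have /andP[] := hf 1; rewrite expr1n !mul1r; exact: le_trans.
near=> h.
have h0 : h != 0 by near: h; exact: nbhs_dnbhs_neq.
have hc : `|h| * c < e.
  have : `|h| < e / (c + 1).
    by near: h; apply: dnbhs0_lt; rewrite divr_gt0 // ltr_wpDl.
  by rewrite ltr_pdivlMr ?ltr_wpDl //; have := normr_ge0 h; nra.
apply: le_lt_trans hc; rewrite /= addrC [h *: v + x]addrC.
have -> : - (h^-1 *: (f (x + h *: v) - f x)) + l =
    - (h^-1 * (f (x + h *: v) - f x - h * l)).
  by rewrite /GRing.scale /=; field.
have /andP[f0 fc] := hf h.
rewrite normrN normrM normfV ger0_norm // ler_pdivrMl ?normr_gt0 //.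
by rewrite mulrA -expr2 real_normK ?num_real.
Unshelve. all: by end_near. Qed.

Lemma dotv_delta (R : realType) (m : nat) (u : 'rV[R]_m) i :
  dotv u (delta_mx 0 i) = u 0 i.
Proof.
rewrite /dotv (bigD1 i) //= big1 => [|j /negPf ji]; rewrite mxE ?ji ?eqxx ?andbF /=.
  by rewrite mulr1 addr0.
by rewrite mulr0.
Qed.

Section DualObjective.
Variables (R : realType) (n m : nat) (C : 'M[R]_n) (A : 'I_m -> 'M[R]_n).
Variables (b : 'rV[R]_m) (N : 'rV[R]_m -> R) (beta : R).
Hypothesis n_gt0 : (0 < n)%N.
Hypotheses (symC : C^T = C) (symA : forall i, (A i)^T = A i).
Hypothesis hNA : forall lam : 'rV[R]_m, spectral_norm (lincomb A lam) <= N lam.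
Hypotheses (hN : is_norm N) (beta_gt0 : 0 < beta).

Let H (lam : 'rV[R]_m) : 'M[R]_n := - beta *: (C - lincomb A lam).

(* [f] stands for the dual objective; only this equation is used, and an opaque
   [f] keeps matrix exponentials out of the arithmetic tactics. *)
Variable f : 'rV[R]_m -> R.
Hypothesis fE : forall lam, f lam = - dotv b lam + beta^-1 * logtrexp (H lam).

Lemma lincombD lam d : lincomb A (lam + d) = lincomb A lam + lincomb A d.
Proof. by rewrite -big_split; apply: eq_bigr => i _; rewrite mxE scalerDl. Qed.

Lemma lincombZ (a : R) d : lincomb A (a *: d) = a *: lincomb A d.
Proof. by rewrite scaler_sumr; apply: eq_bigr => i _; rewrite mxE scalerA. Qed.

Lemma tr_lincomb lam : (lincomb A lam)^T = lincomb A lam.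
Proof.
by rewrite /lincomb linear_sum; apply: eq_bigr => i _; rewrite linearZ /= symA.
Qed.

Lemma lincomb_delta i : lincomb A (delta_mx 0 i) = A i.
Proof.
rewrite /lincomb (bigD1 i) //= big1 => [|j /negPf ji].
  by rewrite mxE !eqxx scale1r addr0.
by rewrite mxE ji andbF scale0r.
Qed.

Lemma mxtrace_lincomb X lam : \tr (lincomb A lam *m X) = \sum_i lam 0 i * \tr (A i *m X).
Proof.
rewrite mulmx_suml linear_sum; apply: eq_bigr => i _.
by rewrite -scalemxAl linearZ.
Qed.

Let symH lam : (H lam)^T = H lam.
Proof. by rewrite /H linearZ /= linearB /= symC tr_lincomb. Qed.

Let HD lam d : H (lam + d) = H lam + beta *: lincomb A d.
Proof. by rewrite /H lincombD; apply/matrixP => i j; rewrite !mxE; ring. Qed.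

(** The candidate directional derivative, confirmed by [dotv_gradient]. *)
Let slope lam d := - dotv b d + \tr (gibbs (H lam) *m lincomb A d).

(** Convexity below and smoothness above for the increment [beta *: lincomb A d], whose squared
    spectral norm is at most [beta ^ 2 * N d ^ 2]; the prefactor [beta^-1] leaves [beta / 2]. *)
Lemma dual_objective_bounds lam d :
  0 <= f (lam + d) - f lam - slope lam d <= beta / 2 * N d ^+ 2.
Proof.
have sD : (beta *: lincomb A d)^T = beta *: lincomb A d by rewrite linearZ /= tr_lincomb.
have hK := mx_sqnorm_leZ beta (spectral_norm_sqnorm_le (tr_lincomb d) (hNA d)).
have := logtrexp_subgradient n_gt0 (symH lam) sD hK.
have := logtrexp_smooth n_gt0 (symH lam) sD hK.
rewrite mxtrace_mulmxZ -HD => up lo.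
have -> : f (lam + d) - f lam - slope lam d =
    beta^-1 * (logtrexp (H (lam + d)) - logtrexp (H lam)
      - beta * \tr (gibbs (H lam) *m lincomb A d)).
  by rewrite /slope !fE dotvDr; field; rewrite gt_eqF.
rewrite mulr_ge0 ?invr_ge0 ?(ltW beta_gt0) //=; last first.
  by rewrite subr_ge0 lerBrDl.
have -> : beta / 2 * N d ^+ 2 = beta^-1 * (beta ^+ 2 * N d ^+ 2 / 2).
  by field; rewrite gt_eqF.
by rewrite ler_wpM2l ?invr_ge0 ?(ltW beta_gt0) // !lerBlDl addrA.
Qed.

Lemma dotv_gradient lam d : dotv (gradient f lam) d = slope lam d.
Proof.
have Df v : 'D_v f lam = slope lam v.
  apply: (@derive_quadratic_bound _ _ _ _ _ _ (beta / 2 * N v ^+ 2)) => h.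
  have := dual_objective_bounds lam (h *: v).
  rewrite /slope dotvZr lincombZ mxtrace_mulmxZ (is_normZ hN) exprMn.
  by rewrite real_normK ?num_real // -mulrN -mulrDr [beta / 2 * _]mulrCA.
rewrite /slope /lincomb mulmx_sumr [\tr _]linear_sum /= /dotv -sumrN -big_split.
apply: eq_bigr => i _ /=.
by rewrite mxE Df /slope lincomb_delta dotv_delta mxtrace_mulmxZ; ring.
Qed.

Lemma dual_objective_smooth lam d :
  f (lam + d) <= f lam + dotv (gradient f lam) d + beta / 2 * N d ^+ 2.
Proof.
have /andP[_] := dual_objective_bounds lam d.
by rewrite -dotv_gradient !lerBlDl addrA.
Qed.

(** With [q] the dual norm of [g], the model decreases by at least [q ^ 2 / (2 beta)], and the
    gradient error costs at most [gamma] times the step length [q / beta]. *)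
Lemma dual_objective_prox_descent g gamma lam lam' :
  dual_norm N (g - gradient f lam) <= gamma ->
  argmin (prox_model N f beta^-1 g lam) lam' ->
  beta * f lam' <= beta * f lam - dual_norm N g * (dual_norm N g - 2 * gamma) / 2.
Proof.
move=> hg /(prox_minimizer hN beta_gt0) []; set d := lam' - lam => gd Nd.
have := dual_objective_smooth lam d; rewrite {1}/d addrC subrK => fd.
have err : dotv (gradient f lam) d - dotv g d <= gamma * N d.
  have -> : dotv (gradient f lam) d - dotv g d = dotv (g - gradient f lam) (- d).
    by rewrite dotvDl !dotvNr dotvNl; ring.
  apply: le_trans (dotv_le_dual_norm hN _ _) _.
  by rewrite (is_normN hN) ler_wpM2r // (is_norm_ge0 hN).
have {fd gd err} : f lam' <= f lam - dual_norm N g ^+ 2 / (2 * beta)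
    + gamma * (dual_norm N g / beta) by rewrite -Nd; lra.
move=> /(ler_wpM2l (ltW beta_gt0)) /le_trans; apply.
by rewrite le_eqVlt; apply/orP; left; apply/eqP; field; rewrite gt_eqF.
Qed.

(** Weak duality: at a feasible [X] the terms [b.lam] cancel, so [f lam >= - Tr (C X)]. At 0 the
    objective involves [C] alone. *)
Lemma dual_objective_gap X lam : psd X -> \tr X = 1 ->
  (forall i, \tr (A i *m X) = b 0 i) ->
  beta * f 0 - beta * f lam <= beta * eig_spread C + ln n%:R.
Proof.
move=> Xpsd X1 AX.
have lower : - beta * \tr (C *m X) <= beta * f lam.
  have := mxtrace_le_logtrexp n_gt0 (symH lam) Xpsd X1.
  rewrite fE mulrDr mulVKf ?gt_eqF // /H -scalemxAl mxtraceZ mulmxBl linearB /=.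
  rewrite mxtrace_lincomb; under eq_bigr do rewrite AX mulrC.
  by rewrite -/(dotv b lam); lra.
have upper : beta * f 0 <= ln n%:R - beta * inf [set a : R | eigenvalue C a].
  have -> : beta * f 0 = logtrexp (- beta *: C).
    rewrite fE dotvE trmx0 mulmx0 mxE oppr0 add0r mulVKf ?gt_eqF // /H.
    by rewrite -(scale0r 0) lincombZ scale0r subr0.
  exact: logtrexp_le (ltW beta_gt0).
have := ler_wpM2l (ltW beta_gt0) (mxtrace_le_max_eigenvalue symC Xpsd X1).
by rewrite /eig_spread; lra.
Qed.

End DualObjective.

(** * Summing the descent over all steps *)

Theorem theorem15 (R : realType) (n m : nat)
    (C : 'M[R]_n) (A : 'I_m -> 'M[R]_n) (b : 'rV[R]_m)
    (hC : C \is symmetricmx) (hA : forall i, A i \is symmetricmx)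
    (hfeas : sdp_feasible A b)
    (N : 'rV[R]_m -> R) (hN : is_norm N)
    (hNA : forall lam : 'rV[R]_m, spectral_norm (lincomb A lam) <= N lam)
    (T : nat) (gamma beta : R)
    (hT : (1 <= T)%N) (hgamma : 0 < gamma) (hbeta : 0 < beta)
    (lam g : nat -> 'rV[R]_m)
    (hlam0 : lam 0%N = 0)
    (hstep : forall t : nat, (t < T)%N ->
       argmin (prox_model N (dual_objective C A b beta) beta^-1 (g t) (lam t))
         (lam t.+1))
    (hg : forall t : nat, (t < T)%N ->
       dual_norm N (g t - gradient (dual_objective C A b beta) (lam t))
         <= gamma) :
  exists t : nat, (t < T)%N /\
    dual_norm N (gradient (dual_objective C A b beta) (lam t))
      <= 3 * gamma + 2 * Num.sqrt (beta * eig_spread C / T%:R)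
         + 2 * Num.sqrt (ln n%:R / T%:R).
Proof.
have symC := symmetricmxE hC; have symA i := symmetricmxE (hA i).
have [X [_ AX X1 Xpsd]] := hfeas.
have n_gt0 : (0 < n)%N.
  case: (posnP n) X1 => // n0; rewrite /mxtrace big1 => [/esym/eqP|i].
    by rewrite oner_eq0.
  by have := ltn_ord i; rewrite {2}n0.
have T_gt0 : 0 < T%:R :> R by rewrite ltr0n.
set f := dual_objective C A b beta in hstep hg *.
have fE v : f v = - dotv b v + beta^-1 * logtrexp (- beta *: (C - lincomb A v)).
  by rewrite logtrexp.unlock.
clearbody f.
set a := beta * eig_spread C / T%:R; set l := ln n%:R / T%:R.
have a0 : 0 <= a.
  by rewrite divr_ge0 ?mulr_ge0 ?(ltW hbeta) ?(ltW T_gt0) ?eig_spread_ge0.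
have l0 : 0 <= l by rewrite divr_ge0 ?(ltW T_gt0) ?ln_ge0 ?ler1n.
apply: contrapT => noT.
(* A large gradient forces [q > 2 gamma + s] with [s = 2 sqrt a + 2 sqrt l], hence
   [q (q - 2 gamma) / 2 > s ^ 2 / 2 >= a + l]. *)
have decrease t : (t < T)%N -> beta * f (lam t.+1) < beta * f (lam t) - (a + l).
  move=> tT.
  have := dual_objective_prox_descent n_gt0 symC symA hNA hN hbeta fE (hg t tT) (hstep t tT).
  move=> /le_lt_trans; apply; rewrite ltrD2l ltrN2.
  have : 3 * gamma + 2 * Num.sqrt a + 2 * Num.sqrt l < dual_norm N (gradient f (lam t)).
    by rewrite ltNge; apply/negP => le; apply: noT; exists t.
  have : dual_norm N (gradient f (lam t)) <= dual_norm N (g t) + gamma.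
    have -> : gradient f (lam t) = g t - (g t - gradient f (lam t)).
      by rewrite opprB addrC subrK.
    apply: le_trans (dual_normD hN _ _) _.
    by rewrite (dual_normN hN) lerD2l; exact: hg.
  have := sqr_sqrtr a0; have := sqr_sqrtr l0.
  have := sqrtr_ge0 a; have := sqrtr_ge0 l.
  move: (Num.sqrt a) (Num.sqrt l) (dual_norm N (g t)) (dual_norm N _) => u v q r.
  move=> v0 u0 <- <- qr rlt.
  have s0 : 0 <= 2 * u + 2 * v by lra.
  have q2 : 2 * gamma + (2 * u + 2 * v) < q by lra.
  nra.
(* Counted from [k.+1], as the strict inequality fails for zero steps. *)
have telescope k : (k < T)%N ->
    beta * f (lam k.+1) < beta * f (lam 0%N) - k.+1%:R * (a + l).
  elim: k => [|k IHk] kT; first by rewrite mul1r; exact: decrease.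
  have := decrease _ kT; have := IHk (ltnW kT).
  by rewrite -[k.+2%:R]natr1; lra.
have := telescope T.-1; rewrite prednK // => /(_ (leqnn _)).
have := dual_objective_gap n_gt0 symC symA hbeta fE (lam T) Xpsd X1 AX.
rewrite hlam0 -/f.
(* The [T] decreases together exceed exactly the initial gap, a contradiction. *)
have -> : beta * eig_spread C + ln n%:R = T%:R * (a + l).
  by rewrite /a /l; field; rewrite gt_eqF.
lra.
Qed.
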